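(* Let $m\ge 2$ and $J\ge 2$ be integers, let $p_1,\dots,p_J$ be distinct primes, let $S=\langle p_1,\dots,p_J\rangle=\{\ell_k\}_{k\ge1}$ with $1=\ell_1<\ell_2<\cdots$ be the multiplicative semigroup they generate, and let $\Omega\subset\Sigma_m=\{0,\dots,m-1\}^{\mathbb N}$ be a nonempty closed set. Then the Minkowski dimension of $X_\Omega^{(S)}$ (exists and) equals $$\dim_M(X_\Omega^{(S)})=\gamma(S)^{-1}\sum_{k=1}^\infty \log_m(A_k)\Bigl(\frac1{\ell_k}-\frac1{\ell_{k+1}}\Bigr)=\gamma(S)^{-1}\Bigl(\log_m(A_1)+\sum_{k=1}^\infty\frac{\log_m(A_{k+1}/A_k)}{\ell_{k+1}}\Bigr).$$
   Context: Here $\mathbb N=\{1,2,\dots\}$ and $S=\{p_1^{a_1}\cdots p_J^{a_J}: a_1,\dots,a_J\in\mathbb Z_{\ge0}\}$, with elements listed in increasing order as $1=\ell_1<\ell_2<\cdots$. Write $(i,S)=1$ if no $p_j$ ($1\le j\le J$) divides $i$. For $x=(x_k)_{k\ge1}\in\Sigma_m$ put $x|_{iS}:=(x_{i\ell_k})_{k\ge1}\in\Sigma_m$, and $$X_\Omega^{(S)}:=\{x\in\Sigma_m:\ x|_{iS}\in\Omega\ \text{for all } i\in\mathbb N \text{ with } (i,S)=1\}.$$ $\gamma(S):=\sum_{k=1}^\infty \frac1{\ell_k}=\prod_{j=1}^J(1-1/p_j)^{-1}$. For $k\ge1$, $\mathrm{Pref}_k(\Omega)=\{u\in\{0,\dots,m-1\}^k:\Omega\cap[u]\ne\emptyset\}$,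 where $[u]$ is the cylinder of all sequences starting with $u$, and $A_k=|\mathrm{Pref}_k(\Omega)|$. $\Sigma_m$ carries the product topology, and dimensions are with respect to the metric $\varrho(x,y)=m^{-\min\{n:\,x_n\ne y_n\}}$ on $\Sigma_m$ (with $\varrho(x,x)=0$). With respect to it, $\dim_M(X)=\lim_{n\to\infty}\frac{\log_m N_n(X)}{n}$ when the limit exists, where $N_n(X)$ is the number of words of length $n$ that are prefixes of some element of $X$. *)

(* Defs.v *)
From HB Require Import structures.
From mathcomp Require Import all_boot all_order all_algebra.
From mathcomp Require Import all_classical all_reals all_analysis.

Set Implicit Arguments.
Unset Strict Implicit.
Unset Printing Implicit Defensive.

Import Order.TTheory GRing.Theory Num.Theory.
Import numFieldNormedType.Exports.

Local Open Scope classical_set_scope.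
Local Open Scope ring_scope.

(* The full shift on m symbols, with the product of the discrete topologies.
   Sequences are indexed from 0: the term x_n (n >= 1) is x n.-1. *)
Notation Sigma m := {ptws nat -> discrete_topology 'I_m}.

Definition semigroup (J : nat) (p : 'I_J -> nat) : set nat :=
  [set n | exists a : 'I_J -> nat, n = (\prod_(j < J) p j ^ a j)%N].

(* Enumerations are indexed from 0 as well: l_k (k >= 1) is ell k.-1. *)
Definition increasing_enumeration (S : set nat) (ell : nat -> nat) : Prop :=
  {homo ell : i j / (i < j)%N} /\ range ell = S.

Definition coprime_to (J : nat) (p : 'I_J -> nat) (i : nat) : Prop :=
  forall j : 'I_J, ~~ (p j %| i)%N.

(* The k-th entry (from 0) of x|_{iS} is x_{i l_{k+1}}. *)
Definition restriction (m : nat) (ell : nat -> nat) (i : nat) (x : Sigma m) :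
    Sigma m :=
  fun k => x (i * ell k).-1%N.

Definition X_ (m J : nat) (p : 'I_J -> nat) (ell : nat -> nat)
    (Omega : set (Sigma m)) : set (Sigma m) :=
  [set x : Sigma m | forall i : nat, (0 < i)%N -> coprime_to p i ->
    Omega (restriction ell i x)].

Definition gamma (R : realType) (ell : nat -> nat) : R :=
  limn (series (fun k => (ell k)%:R^-1 : R)).

Definition cylinder (m n : nat) (u : n.-tuple 'I_m) : set (Sigma m) :=
  [set x : Sigma m | forall i : 'I_n, x i = tnth u i].

Definition Pref (m n : nat) (X : set (Sigma m)) : {set n.-tuple 'I_m} :=
  [set u | `[< X `&` cylinder u !=set0 >]]%SET.

(* Both A_n (when X is Omega) and N_n(X). *)
Definition num_prefixes (m : nat) (X : set (Sigma m)) (n : nat) : nat :=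
  #|Pref n X|.

Definition logb (R : realType) (m : nat) (x : R) : R := ln x / ln m%:R.

(* For the metric m^(- min {n : x_n != y_n}) the cylinders of length n are the
   closed balls of radius m^-(n+1), so the number of prefixes is a covering
   number. *)
Definition has_minkowski_dim (R : realType) (m : nat) (X : set (Sigma m))
    (d : R) : Prop :=
  logb m (num_prefixes X n)%:R / n%:R @[n --> \oo] --> d.

(* Main.v *)
Require Import Defs.
From HB Require Import structures.
From mathcomp Require Import all_boot all_order all_algebra.
From mathcomp Require Import all_classical all_reals all_analysis.
From mathcomp Require Import zify ring lra.

(** Number the elements of S from ell_0 = 1.  Every n >= 1 is uniquely
    i * ell_k with i prime to all the p_j, so the positions of a sequence split
    into the progressions i * S, and membership in X_ Omega constrains each
    progression independently of the others.  Among the first n positions the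
    progression of i occupies
    K(n, i) = #{k : i * ell_k <= n} places; hence, with A_K the number of
    prefixes of Omega of length K and N_n the number of prefixes of X_ Omega of
    length n,
        N_n = \prod_i A_(K(n, i))                     ([num_prefixes_X]).
    Write log A_K as the sum over k < K of the growths
    d_k = log_m (A_(k+1) / A_k), which lie in [0, 1], and exchange the sums:
        log_m N_n = \sum_(k < n) d_k * C(n / ell_k)   ([logb_num_prefixes_X]),
    where C(t) counts the i <= t prime to all the p_j.  Whether i is counted
    depends only on i modulo the product of the p_j, so C is the sum of a linear
    and a periodic function.  Hence C(t) / t has a positive limit delta, and
    C(n / ell_k) / n tends to delta / ell_k ([cvg_sfree_count]) while being at
    most 1 / ell_k.  Tannery's theorem ([tannery]) then gives
        log_m N_n / n --> delta * \sum_k d_k / ell_k.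

    That delta = 1 / gamma is seen from the full shift.  There N_n = m^n and
    d_k = 1, so that the formula above reads n = \sum_(k < n) C(n / ell_k)
    ([sum_sfree_count]).  Truncating this sum bounds the partial sums of
    \sum_k 1 / ell_k by 1 / delta, which proves that this series converges, the
    hypothesis of Tannery's theorem; letting n grow in the whole sum gives delta * gamma = 1 ([sfree_density_gamma]).

    Summation by parts turns \sum_k d_k / ell_k into the series of the
    log A_(k+1) * (1 / ell_k - 1 / ell_(k+1)), the boundary term log A_n / ell_n
    vanishing in the limit ([cvg_sum_div_ell]).  *)

Import Order.TTheory GRing.Theory Num.Theory.
Import numFieldNormedType.Exports.

Local Open Scope classical_set_scope.
Local Open Scope ring_scope.

Set Implicit Arguments.
Unset Strict Implicit.
Unset Printing Implicit Defensive.

(** * The factorization of the positive integers *)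

Definition primes_of {J : nat} (p : 'I_J -> nat) : nat_pred :=
  [pred q | [exists j, p j == q]].

(** Being S-free, in boolean form.  When J > 0 this is false at 0, so that
    counts of S-free integers can start at 0. *)
Definition sfree {J : nat} (p : 'I_J -> nat) (i : nat) : bool :=
  [forall j : 'I_J, ~~ (p j %| i)%N].

Lemma sfreeP J (p : 'I_J -> nat) i : reflect (coprime_to p i) (sfree p i).
Proof. exact: forallP. Qed.

Lemma sfree_gt0 J (p : 'I_J -> nat) i : (0 < J)%N -> sfree p i -> (0 < i)%N.
Proof.
move=> J_gt0 /forallP/(_ (Ordinal J_gt0)).
by case: i => //; rewrite dvdn0.
Qed.

Lemma sfree_pnat J (p : 'I_J -> nat) i : (forall j, prime (p j)) ->
  (0 < i)%N -> sfree p i = (negn (primes_of p)).-nat i.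
Proof.
move=> p_prime i_gt0; apply/forallP/pnatP => // [fi q _ qi|ni j].
  by apply/existsP => -[j /eqP pjq]; move: (fi j); rewrite pjq qi.
apply/negP => /(ni _ (p_prime j))/negP; apply.
by apply/existsP; exists j.
Qed.

(** This and [sfree_pnat] turn the factorization n = i * s into the splitting
    of n into its pi-part and pi'-part, for pi the set of the p_j. *)
Lemma semigroup_pnat J (p : 'I_J -> nat) n : (forall j, prime (p j)) ->
  semigroup p n <-> (primes_of p).-nat n.
Proof.
move=> p_prime; split.
  case=> a ->; apply: (big_ind (fun k => (primes_of p).-nat k)) => //.
    by move=> x y px py; rewrite pnatM px py.
  move=> j _; rewrite pnatX pnatE //; apply/orP; left.
  by apply/existsP; exists j.
elim/ltn_ind: n => n IH pn; have /andP[n_gt0 _] := pn.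
have [n_le1|n_gt1] := leqP n 1.
  exists (fun=> 0%N); rewrite big1 //.
  by apply/eqP; rewrite eqn_leq n_le1.
have /existsP[j /eqP pj] : pdiv n \in primes_of p.
  by apply: (pnatPpi pn); rewrite pi_pdiv.
have nE : n = (p j * (n %/ p j))%N by rewrite mulnC divnK // pj pdiv_dvd.
have [] := IH (n %/ p j)%N.
- by rewrite ltn_Pdiv // pj prime_gt1 // pdiv_prime.
- by apply: pnat_dvd pn; rewrite {2}nE dvdn_mull.
move=> a aE; exists (fun i => if i == j then (a i).+1 else a i).
rewrite {1}nE aE (bigD1 j) //= [RHS](bigD1 j) //= eqxx expnS mulnA.
congr (_ * _)%N; apply: eq_bigr => i /negbTE ij; by rewrite ij.
Qed.

Lemma ell_gtn J (p : 'I_J -> nat) ell k : (forall j, prime (p j)) ->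
  increasing_enumeration (semigroup p) ell -> (k < ell k)%N.
Proof.
move=> p_prime [incr rg]; elim: k => [|k IH].
  have : semigroup p (ell 0%N) by rewrite -rg; exists 0%N.
  by move/(semigroup_pnat _ p_prime)/andP => [].
by apply: leq_ltn_trans IH _; exact: incr.
Qed.

Lemma ell0 J (p : 'I_J -> nat) ell : (forall j, prime (p j)) ->
  increasing_enumeration (semigroup p) ell -> ell 0%N = 1%N.
Proof.
move=> p_prime ellP.
have : semigroup p 1%N by apply/semigroup_pnat.
case: (ellP) => _ <- [k _ ek].
have := ell_gtn k p_prime ellP; rewrite ek ltnS leqn0 => /eqP k0.
by rewrite -ek k0.
Qed.

Lemma ell_leq J (p : 'I_J -> nat) ell :
  increasing_enumeration (semigroup p) ell -> {mono ell : i j / (i <= j)%N}.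
Proof. by case=> incr _; exact: leq_mono. Qed.

(** The conclusion is vacuous at n = 0 so that a choice function for it is
    defined on all of nat. *)
Lemma decomposition J (p : 'I_J -> nat) ell : (forall j, prime (p j)) ->
  increasing_enumeration (semigroup p) ell ->
  forall n, exists ik : nat * nat,
    (0 < n)%N -> sfree p ik.1 /\ n = (ik.1 * ell ik.2)%N.
Proof.
move=> p_prime ellP n; have [n_gt0|_] := ltnP 0 n; last by exists (0, 0)%N.
have : semigroup p (n`_(primes_of p))%N.
  by apply/semigroup_pnat => //; exact: part_pnat.
case: (ellP) => _ <- [k _ ek].
exists ((n`_(negn (primes_of p)))%N, k) => _; rewrite /= ek mulnC partnC //.
by rewrite sfree_pnat ?part_gt0 // part_pnat.
Qed.

(** The factor in S is recovered as the pi-part of the product. *)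
Lemma decomposition_unique J (p : 'I_J -> nat) ell i i' k k' :
  (0 < J)%N -> (forall j, prime (p j)) ->
  increasing_enumeration (semigroup p) ell -> sfree p i -> sfree p i' ->
  (i * ell k)%N = (i' * ell k')%N -> i = i' /\ k = k'.
Proof.
move=> J_gt0 p_prime ellP fi fi' e.
have ell_pnat j : (primes_of p).-nat (ell j).
  by apply/semigroup_pnat => //; case: (ellP) => _ <-; exists j.
have ell_gt0 j : (0 < ell j)%N by exact: leq_ltn_trans (ell_gtn j p_prime ellP).
have i_gt0 := sfree_gt0 J_gt0 fi; have i'_gt0 := sfree_gt0 J_gt0 fi'.
have partE x j : (0 < x)%N -> sfree p x -> ((x * ell j)`_(primes_of p))%N = ell j.
  move=> x_gt0 fx; rewrite partnM //.
  by rewrite part_p'nat -?sfree_pnat // mul1n part_pnat_id.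
have ekk' : ell k = ell k' by rewrite -(partE i) // e partE.
split; last exact: (incn_inj (ell_leq ellP)).
by apply/eqP; rewrite -(eqn_pmul2r (ell_gt0 k')) -{1}ekk' e.
Qed.

(** The number K(n, i) of the positions i * ell_k that are at most n, and 0 when
    i is not prime to all the p_j.  It is found as the first k that fails the
    condition; searching below n is enough because k < ell_k. *)
Definition block_length {J : nat} (p : 'I_J -> nat) (ell : nat -> nat)
    (n i : nat) : nat :=
  find (fun k => ~~ (sfree p i && (i * ell k <= n)%N)) (iota 0 n).

Lemma ltn_block_length J (p : 'I_J -> nat) ell n i k :
  (0 < J)%N -> (forall j, prime (p j)) ->
  increasing_enumeration (semigroup p) ell ->
  (k < block_length p ell n i)%N = sfree p i && (i * ell k <= n)%N.
Proof.
move=> J_gt0 p_prime ellP; rewrite /block_length; set P := (fun k => _).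
have [lt_k|ge_k] := ltnP k.
  have := before_find 0%N lt_k; rewrite nth_iota ?add0n; last first.
    by apply: leq_trans lt_k _; rewrite -[leqRHS](size_iota 0 n) find_size.
  by move/negbFE.
symmetry; apply/negbTE/negP => /andP[fi ik_le].
have i_gt0 := sfree_gt0 J_gt0 fi.
have le_n j : (j <= k)%N -> (i * ell j <= n)%N.
  by move=> jk; apply: leq_trans ik_le; rewrite leq_mul2l (ell_leq ellP) jk orbT.
have kn : (k < n)%N.
  apply: leq_trans (ell_gtn k p_prime ellP) _.
  by apply: leq_trans (leq_pmull _ i_gt0) ik_le.
have hasP : has P (iota 0 n).
  by rewrite has_find size_iota (leq_ltn_trans ge_k).
have := nth_find 0%N hasP; rewrite nth_iota ?add0n; last first.
  by rewrite -[ltnRHS](size_iota 0 n) -has_find.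
by move/negP; apply; rewrite fi le_n.
Qed.

(** * Independence of the progressions *)

Definition initial_word {m : nat} (n : nat) (x : Sigma m) : n.-tuple 'I_m :=
  [tuple x i | i < n].

Lemma PrefP m n (X : set (Sigma m)) (u : n.-tuple 'I_m) :
  reflect (exists2 x, X x & u = initial_word n x) (u \in Pref n X).
Proof.
rewrite inE; apply: (iffP (asboolP _)) => [[x [Xx xu]]|[x Xx ->]].
  by exists x => //; apply: eq_from_tnth => i; rewrite tnth_mktuple xu.
by exists x; split=> // i; rewrite tnth_mktuple.
Qed.

(** A word of length n is cut along the progressions i * S into one block for
    each i <= n.  Cutting is injective because every position lies on some
    progression.  It maps the prefixes of X_ Omega onto the families of prefixes
    of Omega because the progressions are disjoint: points of Omega chosen
    freely, one for each i, assemble into a point of X_ Omega.  For i that are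
    not prime to all the p_j the block is empty and the factor is 1. *)
Lemma num_prefixes_X m J (p : 'I_J -> nat) ell (Omega : set (Sigma m)) n :
  (0 < J)%N -> (forall j, prime (p j)) ->
  increasing_enumeration (semigroup p) ell -> Omega !=set0 ->
  num_prefixes (X_ p ell Omega) n =
    (\prod_(i < n.+1) num_prefixes Omega (block_length p ell n i))%N.
Proof.
move=> J_gt0 p_prime ellP [x0 Omega_x0]; rewrite /num_prefixes.
set K := block_length p ell n.
have KE i k : (k < K i)%N = sfree p i && (i * ell k <= n)%N.
  exact: ltn_block_length.
have ell_gt0 k : (0 < ell k)%N by exact: leq_ltn_trans (ell_gtn k p_prime ellP).
have [dec decP] := choice (decomposition p_prime ellP).
have pos_lt i (k : 'I_(K i)) : ((i * ell k).-1 < n)%N.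
  have := ltn_ord k; rewrite KE => /andP[fi ik_le].
  by rewrite prednK // muln_gt0 (sfree_gt0 J_gt0 fi) ell_gt0.
pose cut (u : n.-tuple 'I_m) :
    {dffun forall i : 'I_n.+1, (K i).-tuple 'I_m} :=
  [ffun i : 'I_n.+1 => [tuple tnth u (Ordinal (pos_lt i k)) | k < K i]].
have cut_initial_word x i :
    cut (initial_word n x) i = initial_word (K i) (restriction ell i x).
  by rewrite ffunE; apply: eq_from_tnth => k; rewrite !tnth_mktuple.
have cut_inj : injective cut.
  move=> u v e; apply: eq_from_tnth => j.
  have [] := decP j.+1 isT; case: (dec _) => i k /= fi jE.
  have i_le : (i < n.+1)%N.
    by rewrite ltnS (leq_trans _ (ltn_ord j)) // jE leq_pmulr.
  have k_lt : (k < K i)%N by rewrite KE fi -jE /=.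
  have := congr1 (fun f : {dffun forall i : 'I_n.+1, (K i).-tuple _} =>
    tnth (f (Ordinal i_le)) (Ordinal k_lt)) e.
  rewrite !ffunE !tnth_mktuple.
  by rewrite (_ : Ordinal _ = j) //; apply/val_inj; rewrite /= -jE.
rewrite -(card_imset _ cut_inj).
rewrite -(@cardsXn _ _ (fun i : 'I_n.+1 => Pref (K i) Omega)).
congr #|pred_of_set _|; apply/setP => f; apply/imsetP/setXnP.
  move=> [u /PrefP[x Xx ->] -> i]; rewrite cut_initial_word.
  have [i_free|i_nfree] := boolP (sfree p i).
    apply/PrefP; exists (restriction ell i x) => //.
    by apply: Xx; [exact: sfree_gt0 i_free|exact/sfreeP].
  apply/PrefP; exists x0 => //; apply: eq_from_tnth => k.
  by have := ltn_ord k; rewrite KE (negbTE i_nfree).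
move=> fP.
have /choice[w wP] (i : nat) : exists w, Omega w /\
    forall i_le : (i < n.+1)%N, f (Ordinal i_le) = initial_word (K i) w.
  have [i_le|i_gt] := pselect (i < n.+1)%N.
    have /PrefP[w Omega_w fE] := fP (Ordinal i_le).
    exists w; split=> // i_le'.
    by rewrite (bool_irrelevance i_le' i_le).
  by exists x0; split=> // i_le.
(* The entry at position n = i * ell_k is the k-th entry of the point of Omega
   chosen for i; positions beyond the word are filled in the same way. *)
pose x : Sigma m := fun q => w (dec q.+1).1 (dec q.+1).2.
have xE i : sfree p i -> restriction ell i x = w i.
  move=> fi; apply/funext => k; rewrite /restriction /x.
  have ik_gt0 : (0 < i * ell k)%N.
    by rewrite muln_gt0 (sfree_gt0 J_gt0 fi) ell_gt0.
  rewrite prednK //; have [] := decP _ ik_gt0.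
  case: (dec _) => i' k' /= fi' e.
  by have [-> ->] := decomposition_unique J_gt0 p_prime ellP fi fi' e.
exists (initial_word n x).
  apply/PrefP; exists x => // i _ /sfreeP fi.
  by rewrite xE //; have [] := wP i.
apply/ffunP => -[i i_le]; rewrite cut_initial_word /=.
have [_ /(_ i_le) ->] := wP i.
have [fi|nfi] := boolP (sfree p i); first by rewrite xE.
apply: eq_from_tnth => k.
by have := ltn_ord k; rewrite KE (negbTE nfi).
Qed.

(** * Growth of the number of prefixes *)

Lemma num_prefixes_gt0 m (X : set (Sigma m)) n :
  X !=set0 -> (0 < num_prefixes X n)%N.
Proof.
by case=> x Xx; apply/card_gt0P; exists (initial_word n x); apply/PrefP; exists x.
Qed.

Lemma num_prefixes0 m (X : set (Sigma m)) : X !=set0 -> num_prefixes X 0 = 1%N.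
Proof.
move=> X0; apply/eqP; rewrite eqn_leq num_prefixes_gt0 // andbT.
by rewrite (leq_trans (max_card _)) // card_tuple.
Qed.

Lemma num_prefixes_setT m n : (0 < m)%N ->
  num_prefixes [set: Sigma m] n = (m ^ n)%N.
Proof.
move=> m_gt0; rewrite /num_prefixes -[in RHS](card_ord m) -card_tuple.
apply: eq_card => u; rewrite !inE; apply/asboolP.
pose x0 := Ordinal m_gt0.
exists (fun i => nth x0 u i : discrete_topology 'I_m); split=> // i.
by rewrite (tnth_nth x0).
Qed.

Definition truncate {T : Type} {n : nat} (u : n.+1.-tuple T) : n.-tuple T :=
  [tuple tnth u (widen_ord (leqnSn n) i) | i < n].

Lemma truncate_initial_word m n (x : Sigma m) :
  truncate (initial_word n.+1 x) = initial_word n x.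
Proof. by apply: eq_from_tnth => i; rewrite !tnth_mktuple. Qed.

(** Truncation maps the prefixes of length n + 1 onto those of length n. *)
Lemma num_prefixes_leS m (X : set (Sigma m)) n :
  (num_prefixes X n <= num_prefixes X n.+1)%N.
Proof.
apply: leq_trans (leq_imset_card truncate (mem (Pref n.+1 X))).
apply/subset_leq_card/fintype.subsetP => u /PrefP[x Xx ->].
by rewrite -truncate_initial_word imset_f //; apply/PrefP; exists x.
Qed.

(** A prefix is determined by its truncation and its last letter. *)
Lemma num_prefixesS_le m (X : set (Sigma m)) n :
  (num_prefixes X n.+1 <= m * num_prefixes X n)%N.
Proof.
pose f (u : n.+1.-tuple 'I_m) := (tnth u ord_max, truncate u).
have f_inj : injective f.
  move=> u v e; have uv_max : tnth u ord_max = tnth v ord_max := congr1 fst e.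
  have uv_trunc : truncate u = truncate v := congr1 snd e.
  apply: eq_from_tnth => i.
  have [i_lt|i_ge] := ltnP i n.
    have := congr1 (fun w => tnth w (Ordinal i_lt)) uv_trunc.
    by rewrite !tnth_mktuple (_ : widen_ord _ _ = i) //; exact/val_inj.
  have -> // : i = ord_max.
  by apply/val_inj/eqP; rewrite eqn_leq i_ge -ltnS ltn_ord.
have -> : (m * num_prefixes X n)%N = #|finset.setX [set: 'I_m]%SET (Pref n X)|.
  by rewrite cardsX cardsT card_ord.
rewrite /num_prefixes -(card_imset _ f_inj).
apply/subset_leq_card/fintype.subsetP => _ /imsetP[_ /PrefP[x Xx ->] ->].
rewrite finset.in_setX finset.in_setT /= truncate_initial_word.
by apply/PrefP; exists x.
Qed.

Lemma logb_ge0 (R : realType) m (x : R) : 1 <= x -> 0 <= logb m x.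
Proof.
move=> x_ge1; rewrite divr_ge0 ?(ln_ge0 x_ge1) //.
by case: m => [|m]; [rewrite ln0|rewrite ln_ge0 // ler1n].
Qed.

Lemma logb_div (R : realType) m (x y : R) : 0 < x -> 0 < y ->
  logb m (x / y) = logb m x - logb m y.
Proof. by move=> x0 y0; rewrite /logb ln_div // mulrBl. Qed.

Lemma logb_base (R : realType) m : (2 <= m)%N -> logb m m%:R = 1 :> R.
Proof. by move=> m_ge2; rewrite /logb divff // gt_eqF // ln_gt0 // ltr1n. Qed.

Lemma logb_prod (R : realType) m (I : Type) (r : seq I) (F : I -> nat) :
  (forall i, 0 < F i)%N ->
  logb m (\prod_(i <- r) F i)%N%:R = \sum_(i <- r) logb m (F i)%:R :> R.
Proof.
move=> F_gt0; elim: r => [|i r IH]; first by rewrite !big_nil /logb ln1 mul0r.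
rewrite !big_cons -IH /logb natrM lnM ?mulrDl // posrE ltr0n //.
exact: prodn_gt0.
Qed.

(** The number d_k: the logarithm of the average number of ways to extend a
    prefix of length k by one letter. *)
Definition prefix_growth (R : realType) {m : nat} (X : set (Sigma m))
    (k : nat) : R :=
  logb m ((num_prefixes X k.+1)%:R / (num_prefixes X k)%:R).

Lemma prefix_growth_ge0 (R : realType) m (X : set (Sigma m)) k :
  X !=set0 -> 0 <= prefix_growth R X k.
Proof.
move=> X0; apply: logb_ge0; rewrite ler_pdivlMr ?ltr0n ?num_prefixes_gt0 //.
by rewrite mul1r ler_nat num_prefixes_leS.
Qed.

Lemma prefix_growth_le1 (R : realType) m (X : set (Sigma m)) k : (2 <= m)%N ->
  X !=set0 -> prefix_growth R X k <= 1.
Proof.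
move=> m_ge2 X0; rewrite -(logb_base R m_ge2) /prefix_growth /logb.
rewrite ler_pM2r ?invr_gt0 ?ln_gt0 ?ltr1n //.
have A_gt0 i : 0 < (num_prefixes X i)%:R :> R by rewrite ltr0n num_prefixes_gt0.
have m_gt0 : 0 < m%:R :> R by rewrite ltr0n ltnW.
rewrite ler_ln ?posrE ?divr_gt0 //.
by rewrite ler_pdivrMr // -natrM ler_nat num_prefixesS_le.
Qed.

Lemma logb_num_prefixes (R : realType) m (X : set (Sigma m)) n : X !=set0 ->
  logb m (num_prefixes X n)%:R = \sum_(0 <= k < n) prefix_growth R X k.
Proof.
move=> X0; rewrite (eq_bigr (fun k => logb m (num_prefixes X k.+1)%:R -
    logb m (num_prefixes X k)%:R)); last first.
  by move=> k _; rewrite -logb_div ?ltr0n ?num_prefixes_gt0.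
rewrite (telescope_sumr (fun k => logb m (num_prefixes X k)%:R)) //.
by rewrite num_prefixes0 // /logb ln1 mul0r subr0.
Qed.

(** * Exchange of the sums over progressions and over the semigroup *)

Definition sfree_count {J : nat} (p : 'I_J -> nat) (t : nat) : nat :=
  (\sum_(0 <= i < t.+1) sfree p i)%N.

(** Both sides sum d_k over the pairs (i, k) with i prime to all the p_j and
    i * ell_k <= n, on the left for fixed i and on the right for fixed k. *)
Lemma sum_block_length (R : realType) J (p : 'I_J -> nat) ell (d : nat -> R) n :
  (0 < J)%N -> (forall j, prime (p j)) ->
  increasing_enumeration (semigroup p) ell ->
  \sum_(i < n.+1) \sum_(0 <= k < block_length p ell n i) d k =
  \sum_(0 <= k < n) d k * (sfree_count p (n %/ ell k))%:R.
Proof.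
move=> J_gt0 p_prime ellP.
rewrite (eq_bigr (fun i : 'I_n.+1 => \sum_(0 <= k < n)
    d k * (sfree p i && (i * ell k <= n)%N)%:R)); last first.
  move=> i _; rewrite [RHS](bigID (fun k => (k < block_length p ell n i)%N)) /=.
  rewrite [X in _ + X]big1 ?addr0; last first.
    move=> k; rewrite ltn_block_length // => /negbTE ->.
    by rewrite mulr0.
  rewrite (big_nat_widen _ _ n) /=; last first.
    by rewrite /block_length -[leqRHS](size_iota 0 n) find_size.
  by apply: eq_bigr => k; rewrite ltn_block_length // => ->; rewrite mulr1.
rewrite exchange_big /=; apply: eq_bigr => k _.
have ell_gt0 : (0 < ell k)%N by exact: leq_ltn_trans (ell_gtn k p_prime ellP).
rewrite -mulr_sumr; congr (_ * _); rewrite /sfree_count -natr_sum; congr _%:R.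
rewrite (big_nat_widen _ _ n.+1) ?ltnS ?leq_div // big_mkord [RHS]big_mkcond /=.
apply: eq_bigr => i _; rewrite ltnS leq_divRL //.
by case: ifP; rewrite ?andbT ?andbF.
Qed.

Lemma logb_num_prefixes_X (R : realType) m J (p : 'I_J -> nat) ell
    (Omega : set (Sigma m)) n :
  (0 < J)%N -> (forall j, prime (p j)) ->
  increasing_enumeration (semigroup p) ell -> Omega !=set0 ->
  logb m (num_prefixes (X_ p ell Omega) n)%:R =
  \sum_(0 <= k < n) prefix_growth R Omega k * (sfree_count p (n %/ ell k))%:R.
Proof.
move=> J_gt0 p_prime ellP Omega0; rewrite -sum_block_length //.
rewrite num_prefixes_X // logb_prod => [|i]; last exact: num_prefixes_gt0.
by apply: eq_bigr => i _; rewrite logb_num_prefixes.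
Qed.

(** This counts the integers from 1 to n by their factor in S.  It is the formula
    for the number of prefixes in the case of the full shift, on two symbols
    say: there X_ Omega is everything and d_k = 1. *)
Lemma sum_sfree_count (R : realType) J (p : 'I_J -> nat) ell n :
  (0 < J)%N -> (forall j, prime (p j)) ->
  increasing_enumeration (semigroup p) ell ->
  n%:R = \sum_(0 <= k < n) (sfree_count p (n %/ ell k))%:R :> R.
Proof.
move=> J_gt0 p_prime ellP.
have T0 : [set: Sigma 2] !=set0 by exists (fun=> ord0).
have logbX k : logb 2 (num_prefixes [set: Sigma 2] k)%:R = k%:R :> R.
  rewrite num_prefixes_setT // natrX /logb lnXn ?ltr0n // mulrnAl.
  by rewrite divff // gt_eqF // ln_gt0 // ltr1n.
have XT : X_ p ell [set: Sigma 2] = [set: Sigma 2].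
  by apply/seteqP; split.
rewrite -[LHS]logbX -XT logb_num_prefixes_X //; apply: eq_bigr => k _.
rewrite /prefix_growth logb_div ?ltr0n ?num_prefixes_gt0 // !logbX.
by rewrite -natr1 addrAC subrr add0r mul1r.
Qed.

(** * Density of the integers prime to all the p_j *)

Lemma sfree_count_le J (p : 'I_J -> nat) t :
  (0 < J)%N -> (sfree_count p t <= t)%N.
Proof.
move=> J_gt0; rewrite /sfree_count big_nat_recl //= (_ : sfree p 0 = false).
  rewrite add0n -[leqRHS]subn0 -[leqRHS]muln1 -sum_nat_const_nat.
  by apply: leq_sum => i _; exact: leq_b1.
by apply/negbTE/negP => /(sfree_gt0 J_gt0).
Qed.

Definition period {J : nat} (p : 'I_J -> nat) : nat := (\prod_(j < J) p j)%N.

Lemma period_gt0 J (p : 'I_J -> nat) : (forall j, prime (p j)) ->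
  (0 < period p)%N.
Proof. by move=> p_prime; rewrite prodn_gt0 // => j; exact: prime_gt0. Qed.

Lemma sfree_count_period J (p : 'I_J -> nat) t :
  (0 < J)%N -> (forall j, prime (p j)) ->
  sfree_count p (t + period p) = (sfree_count p t + sfree_count p (period p))%N.
Proof.
move=> J_gt0 p_prime.
have free0 : sfree p 0 = false by apply/negbTE/negP => /(sfree_gt0 J_gt0).
have freeD i : sfree p (i + period p) = sfree p i.
  apply: eq_forallb => j; rewrite dvdn_addl //.
  by rewrite /period (bigD1 j) //= dvdn_mulr.
have countS i : sfree_count p i.+1 = (sfree_count p i + sfree p i.+1)%N.
  by rewrite /sfree_count big_nat_recr.
elim: t => [|t IH]; first by rewrite add0n {2}/sfree_count big_nat1 free0.
by rewrite addSn !countS IH -addSn freeD addnAC.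
Qed.

Lemma sfree_count_period_gt0 J (p : 'I_J -> nat) : (forall j, prime (p j)) ->
  (0 < sfree_count p (period p))%N.
Proof.
move=> p_prime; have := period_gt0 p_prime; case: (period p) => // P _.
rewrite /sfree_count !big_nat_recl //= (_ : sfree p 1) ?addn_gt0 ?orbT //.
by apply/forallP => j; rewrite dvdn1 neq_ltn prime_gt1 ?orbT.
Qed.

(** Write t = q * P + r.  The multiples of P contribute exactly q * C P, and the
    remainder r < P changes each of the two terms by an amount in [0, P]. *)
Lemma additive_count_dist (R : realType) (C : nat -> nat) (P t : nat) :
  (0 < P)%N -> (forall t, C (t + P) = C t + C P)%N ->
  (forall t, C t <= t)%N ->
  `|(C t)%:R - (C P)%:R / P%:R * t%:R| <= P%:R :> R.
Proof.
move=> P_gt0 C_add C_le.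
have C_addM q r : C (q * P + r)%N = (q * C P + C r)%N.
  elim: q => [|q IH]; first by rewrite !mul0n !add0n.
  by rewrite !mulSn -addnA addnC C_add IH; lia.
have P_gt0R : 0 < P%:R :> R by rewrite ltr0n.
have PnR : P%:R != 0 :> R by rewrite gt_eqF.
set r := (t %% P)%N.
have r_lt : (r < P)%N by rewrite ltn_mod.
have -> : (C t)%:R - (C P)%:R / P%:R * t%:R =
    (C r)%:R - (C P)%:R / P%:R * r%:R :> R.
  rewrite {1 2}(divn_eq t P) C_addM !natrD !natrM.
  by field.
have Cr_le : (C r)%:R <= P%:R :> R.
  by rewrite ler_nat (leq_trans (C_le r)) // ltnW.
have dens_ge0 : 0 <= (C P)%:R / P%:R :> R by rewrite divr_ge0.
have r_le : (C P)%:R / P%:R * r%:R <= P%:R :> R.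
  apply: le_trans (_ : 1 * P%:R <= _); last by rewrite mul1r.
  by apply: ler_pM => //; rewrite ?ler_pdivrMr ?mul1r ?ler_nat // ltnW.
have := mulr_ge0 dens_ge0 (ler0n R r).
have := ler0n R (C r).
by rewrite ler_norml; lra.
Qed.

Definition sfree_density (R : realType) {J : nat} (p : 'I_J -> nat) : R :=
  (sfree_count p (period p))%:R / (period p)%:R.

Lemma sfree_density_gt0 (R : realType) J (p : 'I_J -> nat) :
  (forall j, prime (p j)) -> 0 < sfree_density R p.
Proof.
move=> p_prime.
by rewrite divr_gt0 // ltr0n ?sfree_count_period_gt0 ?period_gt0.
Qed.

(** Before the division by n the error is at most period + 1:
    [additive_count_dist] costs the period, and rounding n / l down costs at
    most the density, hence at most 1. *)
Lemma cvg_sfree_count (R : realType) J (p : 'I_J -> nat) (l : nat) :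
  (0 < J)%N -> (forall j, prime (p j)) -> (0 < l)%N ->
  (sfree_count p (n %/ l))%:R / n%:R @[n --> \oo] -->
    sfree_density R p / l%:R.
Proof.
move=> J_gt0 p_prime l_gt0; set dens := sfree_density R p.
have P_gt0 := period_gt0 p_prime.
have l_gt0R : 0 < l%:R :> R by rewrite ltr0n.
have dens_ge0 : 0 <= dens by exact/ltW/sfree_density_gt0.
have dens_le1 : dens <= 1.
  by rewrite ler_pdivrMr ?ltr0n // mul1r ler_nat sfree_count_le.
have dist n : (0 < n)%N -> `|dens / l%:R - (sfree_count p (n %/ l))%:R / n%:R| <=
    ((period p)%:R + 1) / n%:R.
  move=> n_gt0; have n_gt0R : 0 < n%:R :> R by rewrite ltr0n.
  rewrite ler_pdivlMr // -[X in _ * X](ger0_norm (ler0n R n)) -normrM.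
  set t := (n %/ l)%N.
  have tE : n%:R = t%:R * l%:R + (n %% l)%:R :> R.
    by rewrite -natrM -natrD -divn_eq.
  have s_ge0 : 0 <= (n %% l)%:R / l%:R :> R by rewrite divr_ge0.
  have s_le1 : (n %% l)%:R / l%:R <= 1 :> R.
    by rewrite ler_pdivrMr // mul1r ler_nat ltnW // ltn_mod.
  have -> : (dens / l%:R - (sfree_count p t)%:R / n%:R) * n%:R =
      dens * ((n %% l)%:R / l%:R) - ((sfree_count p t)%:R - dens * t%:R).
    rewrite mulrBl divfK ?gt_eqF // {1}tE; field.
    by rewrite gt_eqF.
  have := @additive_count_dist R (sfree_count p) (period p) t P_gt0
    (fun t => sfree_count_period t J_gt0 p_prime)
    (fun t => sfree_count_le p t J_gt0).
  rewrite -/(sfree_density R p) -/dens => count_dist.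
  apply: le_trans (ler_normB _ _) _; rewrite addrC lerD //.
  by rewrite ger0_norm ?mulr_ge0 // -[leRHS]mulr1 ler_pM.
apply/cvgrPdist_le => e e_gt0; near=> n.
have n_gt0 : (0 < n)%N by near: n; exact: nbhs_infty_gt.
apply: le_trans (dist n n_gt0) _.
rewrite ler_pdivrMr ?ltr0n // mulrC -ler_pdivrMr //.
by apply/ltW; near: n; exact: nbhs_infty_gtr.
Unshelve. all: by end_near. Qed.

(** * Tannery's theorem and summation by parts *)

Lemma cvg_sum_nat (R : realType) (f : nat -> nat -> R) (h : nat -> R) K :
  (forall k, f n k @[n --> \oo] --> h k) ->
  \sum_(0 <= k < K) f n k @[n --> \oo] --> \sum_(0 <= k < K) h k.
Proof.
move=> fh; elim: K => [|K IH].
  rewrite big_nil (_ : (fun n => _) = cst 0); first exact: cvg_cst.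
  by apply/funext => n; rewrite big_nil.
rewrite big_nat_recr //= (_ : (fun n => _) =
    (fun n => \sum_(0 <= k < K) f n k + f n K)); first exact: cvgD.
by apply/funext => n; rewrite big_nat_recr.
Qed.

(** Dominated convergence for series, in the triangular form where the n-th sum
    has n terms.  Choose K such that both series are within e / 3 of their sums
    after K terms; the K first terms converge, and the domination by g makes the
    others small uniformly in n. *)
Lemma tannery (R : realType) (f : nat -> nat -> R) (g h : nat -> R) :
  (forall n k, (k < n)%N -> `|f n k| <= g k) ->
  (forall k, f n k @[n --> \oo] --> h k) ->
  cvgn (series g) ->
  cvgn (series h) /\
  \sum_(0 <= k < n) f n k @[n --> \oo] --> limn (series h).
Proof.
move=> fg fh cvg_g.
have g_ge0 k : 0 <= g k by exact: le_trans (fg k.+1 k _).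
have hg k : `|h k| <= g k.
  apply: (ler_cvg_to (cvg_norm (fh k)) (cvg_cst (g k))).
  near=> n; apply: fg; near: n; exact: nbhs_infty_ge.
have cvg_h : cvgn (series h).
  by apply: normed_cvg; exact: (series_le_cvg _ _ hg cvg_g).
split=> //; apply/cvgrPdist_le => e e_gt0.
have e3_gt0 : 0 < e / 3 by rewrite divr_gt0.
have [K hK gK] : exists2 K, `|limn (series h) - series h K| <= e / 3 &
    `|limn (series g) - series g K| <= e / 3.
  near \oo => K; exists K.
    by near: K; have /cvgrPdist_le/(_ _ e3_gt0) := cvg_h.
  by near: K; have /cvgrPdist_le/(_ _ e3_gt0) := cvg_g.
near=> n.
have Kn : (K <= n)%N by near: n; exact: nbhs_infty_ge.
have headK : `|series h K - \sum_(0 <= k < K) f n k| <= e / 3.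
  near: n; have /cvgrPdist_le/(_ _ e3_gt0) := @cvg_sum_nat R f h K fh; exact.
have tailK : `|\sum_(K <= k < n) f n k| <= e / 3.
  apply: le_trans (ler_norm_sum _ _ _) _.
  apply: le_trans (_ : \sum_(K <= k < n) g k <= _).
    by rewrite !big_nat; apply: ler_sum => k /andP[_ kn]; exact: fg.
  rewrite -sub_series_geq //; apply: le_trans gK.
  apply: le_trans (ler_norm _); rewrite lerB //.
  apply: nondecreasing_cvgn_le => //.
  by apply: nondecreasing_series => k _ _.
rewrite (big_cat_nat (leq0n K) Kn) //=.
have -> : limn (series h) - (\sum_(0 <= k < K) f n k + \sum_(K <= k < n) f n k) =
  (limn (series h) - series h K) + (series h K - \sum_(0 <= k < K) f n k) -
  \sum_(K <= k < n) f n k by ring.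
apply: le_trans (ler_normB _ _) _.
have : `|limn (series h) - series h K + (series h K - \sum_(0 <= k < K) f n k)|
  <= e / 3 + e / 3 by exact: le_trans (ler_normD _ _) (lerD hK headK).
by move: tailK; lra.
Unshelve. all: by end_near. Qed.

(** Tannery's theorem again: the term d k / ell n tends to 0 for each k, and for
    k < n it is at most 1 / ell k. *)
Lemma cvg_sum_div_ell (R : realType) (d : nat -> R) (ell : nat -> nat) :
  (forall k, 0 <= d k <= 1) -> (forall k, 0 < ell k)%N ->
  {homo ell : i j / (i < j)%N} ->
  cvgn (series (fun k => (ell k)%:R^-1 : R)) ->
  (\sum_(0 <= k < n) d k) / (ell n)%:R @[n --> \oo] --> (0 : R).
Proof.
move=> d01 ell_gt0 ell_incr cvg_inv.
have [|k|_] := @tannery R (fun n k => d k / (ell n)%:R)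
    (fun k => (ell k)%:R^-1) (fun=> 0) _ _ cvg_inv.
- move=> n k kn; have /andP[d_ge0 d_le1] := d01 k.
  rewrite ger0_norm ?divr_ge0 // -[leRHS]mul1r ler_pM ?invr_ge0 //.
  by rewrite lef_pV2 ?posrE ?ltr0n // ler_nat ltnW // ell_incr.
- rewrite -(mulr0 (d k)); apply: cvgM; first exact: cvg_cst.
  exact: cvg_series_cvg_0 cvg_inv.
have -> : series (fun=> 0 : R) = cst 0.
  by apply/funext => n; rewrite /series /= big1.
rewrite lim_cst //.
have -> // : (fun n => \sum_(0 <= k < n) d k / (ell n)%:R) =
  (fun n => (\sum_(0 <= k < n) d k) / (ell n)%:R).
by apply/funext => n; rewrite mulr_suml.
Qed.

Lemma abel_sum (R : realType) (d v : nat -> R) n :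
  \sum_(0 <= k < n) (\sum_(0 <= j < k.+1) d j) * (v k - v k.+1) =
  \sum_(0 <= k < n) d k * v k - (\sum_(0 <= j < n) d j) * v n.
Proof.
elim: n => [|n IH]; first by rewrite !big_nil mul0r subrr.
by rewrite big_nat_recr //= IH !(big_nat_recr n) //=; ring.
Qed.

(** * The limit of the weighted counts and the value of gamma *)

Lemma sfree_count_div_le (R : realType) J (p : 'I_J -> nat) n l :
  (0 < J)%N -> (0 < n)%N -> (0 < l)%N ->
  (sfree_count p (n %/ l))%:R / n%:R <= l%:R^-1 :> R.
Proof.
move=> J_gt0 n_gt0 l_gt0.
rewrite ler_pdivrMr ?ltr0n // mulrC ler_pdivlMr ?ltr0n //.
by rewrite -natrM ler_nat -leq_divRL // sfree_count_le.
Qed.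

(** Each partial sum of the 1 / ell k, times the density, is the limit of
    \sum_(k < K) C(n / ell k) / n, and this is at most 1 by
    [sum_sfree_count]. *)
Lemma cvg_inv_ell (R : realType) J (p : 'I_J -> nat) ell :
  (0 < J)%N -> (forall j, prime (p j)) ->
  increasing_enumeration (semigroup p) ell ->
  cvgn (series (fun k => (ell k)%:R^-1 : R)).
Proof.
move=> J_gt0 p_prime ellP; set dens := sfree_density R p.
have ell_gt0 k : (0 < ell k)%N by exact: leq_ltn_trans (ell_gtn k p_prime ellP).
have dens_gt0 : 0 < dens by exact: sfree_density_gt0.
apply: nondecreasing_is_cvgn.
  by apply: nondecreasing_series => k _ _; rewrite invr_ge0.
exists dens^-1 => _ [K _ <-].
rewrite -[leRHS]mul1r ler_pdivlMr // mulrC /series /= mulr_sumr.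
have cvgK := @cvg_sum_nat R
  (fun n k => (sfree_count p (n %/ ell k))%:R / n%:R) _ K
  (fun k => @cvg_sfree_count R _ _ _ J_gt0 p_prime (ell_gt0 k)).
apply: (ler_cvg_to cvgK (cvg_cst (1 : R))); near=> n.
have n_gt0 : (0 < n)%N by near: n; exact: nbhs_infty_gt.
have Kn : (K <= n)%N by near: n; exact: nbhs_infty_ge.
rewrite -mulr_suml ler_pdivrMr ?ltr0n // mul1r.
rewrite [leRHS](sum_sfree_count R n J_gt0 p_prime ellP).
rewrite (big_cat_nat (leq0n K) Kn) //=.
by rewrite lerDl sumr_ge0.
Unshelve. all: by end_near. Qed.

Lemma cvg_weighted_sfree_count (R : realType) J (p : 'I_J -> nat) ell
    (d : nat -> R) :
  (0 < J)%N -> (forall j, prime (p j)) ->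
  increasing_enumeration (semigroup p) ell ->
  (forall k, 0 <= d k <= 1) ->
  cvgn (series (fun k => d k / (ell k)%:R)) /\
  (\sum_(0 <= k < n) d k * (sfree_count p (n %/ ell k))%:R) / n%:R
    @[n --> \oo] -->
  sfree_density R p * limn (series (fun k => d k / (ell k)%:R)).
Proof.
move=> J_gt0 p_prime ellP d01; set dens := sfree_density R p.
have ell_gt0 k : (0 < ell k)%N by exact: leq_ltn_trans (ell_gtn k p_prime ellP).
have cvg_inv := @cvg_inv_ell R _ _ _ J_gt0 p_prime ellP.
have cvg_d : cvgn (series (fun k => d k / (ell k)%:R)).
  apply: (series_le_cvg _ _ _ cvg_inv) => k; have /andP[d_ge0 d_le1] := d01 k.
  - by rewrite divr_ge0.
  - by rewrite invr_ge0.
  - by rewrite -[leRHS]mul1r ler_pM ?invr_ge0.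
split=> //.
pose f n k := d k * ((sfree_count p (n %/ ell k))%:R / n%:R).
have [|k|_] := @tannery R f (fun k => (ell k)%:R^-1)
    (fun k => d k * (dens / (ell k)%:R)) _ _ cvg_inv.
- move=> n k kn; have /andP[d_ge0 d_le1] := d01 k.
  have n_gt0 : (0 < n)%N by exact: leq_ltn_trans kn.
  rewrite ger0_norm ?mulr_ge0 ?divr_ge0 // -[leRHS]mul1r ler_pM ?divr_ge0 //.
  exact: sfree_count_div_le.
- by apply: cvgM; [exact: cvg_cst|exact: cvg_sfree_count].
have -> : (fun k => d k * (dens / (ell k)%:R)) =
    dens *: (fun k => d k / (ell k)%:R).
  by apply/funext => k; rewrite /GRing.scale /= mulrCA.
rewrite lim_seriesZ //.
have -> // : (fun n => \sum_(0 <= k < n) f n k) = (fun n =>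
    (\sum_(0 <= k < n) d k * (sfree_count p (n %/ ell k))%:R) / n%:R).
apply/funext => n; rewrite mulr_suml.
by apply: eq_bigr => k _; rewrite /f mulrA.
Qed.

(** For constant weight 1 the weighted count divided by n is 1 for every n > 0,
    by [sum_sfree_count], and tends to the density times gamma. *)
Lemma sfree_density_gamma (R : realType) J (p : 'I_J -> nat) ell :
  (0 < J)%N -> (forall j, prime (p j)) ->
  increasing_enumeration (semigroup p) ell ->
  sfree_density R p = (gamma R ell)^-1.
Proof.
move=> J_gt0 p_prime ellP.
have [|_] := @cvg_weighted_sfree_count R J p ell (fun=> 1) J_gt0 p_prime ellP.
  by move=> k; rewrite ler01 lexx.
have -> : (fun k => 1 / (ell k)%:R) = (fun k => (ell k)%:R^-1) :> (nat -> R).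
  by apply/funext => k; rewrite div1r.
rewrite -/(gamma R ell) => cvg1.
have lim1 : (\sum_(0 <= k < n) 1 * (sfree_count p (n %/ ell k))%:R) / n%:R
    @[n --> \oo] --> (1 : R).
  apply: cvg_near_cst; near=> n.
  have n_gt0 : (0 < n)%N by near: n; exact: nbhs_infty_gt.
  under eq_bigr do rewrite mul1r.
  rewrite -(@sum_sfree_count R _ _ _ n J_gt0 p_prime ellP).
  by rewrite divff ?pnatr_eq0 -?lt0n.
have dens_gamma : sfree_density R p * gamma R ell = 1.
  exact: (cvg_unique _ cvg1 lim1).
have gamma_neq0 : gamma R ell != 0.
  by apply: contra_eq_neq dens_gamma => ->; rewrite mulr0 eq_sym oner_neq0.
by apply: (mulIf gamma_neq0); rewrite dens_gamma mulVf.
Unshelve. all: by end_near. Qed.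

(** * The Minkowski dimension *)

Theorem theorem2p1 (R : realType) (m J : nat) (hm : (2 <= m)%N)
  (hJ : (2 <= J)%N) (p : 'I_J -> nat) (p_prime : forall j, prime (p j))
  (p_inj : injective p) (ell : nat -> nat)
  (ellP : increasing_enumeration (semigroup p) ell)
  (Omega : set (Sigma m)) (Omega_neq0 : Omega !=set0)
  (Omega_closed : closed Omega) :
  let A := num_prefixes Omega in
  let a : nat -> R := fun k =>
    logb m (A k.+1)%:R * ((ell k)%:R^-1 - (ell k.+1)%:R^-1) in
  let b : nat -> R := fun k =>
    logb m ((A k.+2)%:R / (A k.+1)%:R) / (ell k.+1)%:R in
  [/\ cvgn (series a), cvgn (series b),
      has_minkowski_dim (X_ p ell Omega)
        ((gamma R ell)^-1 * limn (series a)) &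
      (gamma R ell)^-1 * limn (series a) =
        (gamma R ell)^-1 * (logb m (A 1%N)%:R + limn (series b))].
Proof.
move=> A a b; have J_gt0 : (0 < J)%N by exact: ltnW.
set d := prefix_growth R Omega.
have d01 k : 0 <= d k <= 1.
  by rewrite prefix_growth_ge0 // prefix_growth_le1.
have ell_gt0 k : (0 < ell k)%N by exact: leq_ltn_trans (ell_gtn k p_prime ellP).
have [cvg_d cvg_dim] := cvg_weighted_sfree_count J_gt0 p_prime ellP d01.
set L := limn (series (fun k => d k / (ell k)%:R)) in cvg_dim.
have cvg_a : series a @ \oo --> L.
  have -> : series a = (fun n => series (fun k => d k / (ell k)%:R) n -
      (\sum_(0 <= k < n) d k) / (ell n)%:R).
    apply/funext => n; rewrite -(abel_sum d (fun k => (ell k)%:R^-1)).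
    by apply: eq_bigr => k _; rewrite /a logb_num_prefixes.
  rewrite -[L]subr0; apply: cvgB => //.
  apply: cvg_sum_div_ell => //; first by case: ellP.
  exact: cvg_inv_ell ellP.
(* The series of the d_k / ell_k starts with log A_1, because A_0 = 1 and
   ell_0 = 1; the remaining terms are those of b. *)
have cvg_b : series b @ \oo --> L - logb m (A 1%N)%:R.
  have -> : series b = (fun n =>
      series (fun k => d k / (ell k)%:R) n.+1 - logb m (A 1%N)%:R).
    apply/funext => n; rewrite /series /= big_nat_recl //= (ell0 p_prime ellP).
    by rewrite divr1 logb_num_prefixes // big_nat1 addrC addKr.
  apply: cvgB; last exact: cvg_cst.
  by rewrite (cvg_shiftS (series (fun k => d k / (ell k)%:R))).
have lim_a : limn (series a) = L by exact/cvg_lim.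
have lim_b : limn (series b) = L - logb m (A 1%N)%:R by exact/cvg_lim.
split.
- exact: cvgP cvg_a.
- exact: cvgP cvg_b.
- rewrite lim_a -(sfree_density_gamma R J_gt0 p_prime ellP) /has_minkowski_dim.
  have -> // : (fun n => logb m (num_prefixes (X_ p ell Omega) n)%:R / n%:R) =
    (fun n => (\sum_(0 <= k < n) d k * (sfree_count p (n %/ ell k))%:R) /
      n%:R) :> (nat -> R).
  by apply/funext => n; rewrite logb_num_prefixes_X.
- by rewrite lim_a lim_b subrKC.
Qed.
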